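(* Fix $A>1$. There is a constant $K_A>0$ depending only on $A$ such that the following holds. Let $n\ge 2$, let $I$ be a nonempty, proper subset of $[n]$ with $H(I)\le\frac12H_n$, let $k$ be an integer with $2\le k\le A\log n$ and $k\le n$, and let $p=H(I)/H_n\le\frac12$. For any $0\le\psi\le\sqrt{p(1-p)(k-1)}$ we have \[ \mathbb{P}\Big(|C_I(\sigma)-p(k-1)|\ge\psi\sqrt{p(1-p)(k-1)}\;\Big|\;C(\sigma)=k\Big)\le K_A\,e^{-\frac13\psi^2}. \]
   Context: $[n]=\{1,\ldots,n\}$. The probability $\mathbb{P}$ is with respect to a uniformly random permutation $\sigma$ in the symmetric group $\mathcal{S}_n$ on $[n]$; $\mathbb{P}(\cdot\mid\cdot)$ denotes conditional probability. For $I\subseteq[n]$, $C_I(\sigma)$ is the number of cycles of $\sigma$ whose lengths lie in $I$ (fixed points count as cycles of length 1), $C(\sigma)$ is the total number of cycles of $\sigma$, $H(I)=\sum_{j\in I}1/j$, and $H_n=\sum_{i=1}^n1/i$. *)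

(* Defs.v *)
From HB Require Import structures.
From mathcomp Require Import all_boot all_order all_algebra all_fingroup.
From mathcomp Require Import reals sequences exp.

Set Implicit Arguments.
Unset Strict Implicit.
Unset Printing Implicit Defensive.

Import Order.TTheory GRing.Theory Num.Theory.
Local Open Scope ring_scope.

(* [n] = {1, ..., n}, as a set of elements of 'I_n.+1 = {0, ..., n}, so that
   an element of a subset of [n] is literally a cycle length. The permutations
   in 'S_n act on 'I_n = {0, ..., n-1}, which relabels the ground set only. *)
Definition brack (n : nat) : {set 'I_n.+1} := [set j : 'I_n.+1 | (0 < j)%N].

(* porbits s contains the fixed points, as cycles of length 1. *)
Definition ncycles (n : nat) (s : 'S_n) : nat := #|porbits s|.

Definition ncycles_in (n : nat) (I : {set 'I_n.+1}) (s : 'S_n) : nat :=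
  #|[set c in porbits s | [exists j in I, #|c| == j :> nat]]|.

Definition harm_set (R : realType) (n : nat) (I : {set 'I_n.+1}) : R :=
  \sum_(j in I) (j : nat)%:R^-1.

Definition harm (R : realType) (n : nat) : R :=
  \sum_(1 <= i < n.+1) i%:R^-1.

Definition prob (R : realType) (n : nat) (E : {set 'S_n}) : R :=
  #|E|%:R / #|[set: 'S_n]|%:R.

Definition cond_prob (R : realType) (n : nat) (E F : {set 'S_n}) : R :=
  prob R (E :&: F) / prob R F.

(* Main.v *)
Require Import Defs.
From HB Require Import structures.
From mathcomp Require Import all_boot all_order all_algebra all_fingroup.
From mathcomp Require Import reals sequences exp.
From mathcomp Require Import topology normedtype derive.
From mathcomp Require Import ring lra.

Set Implicit Arguments.
Unset Strict Implicit.
Unset Printing Implicit Defensive.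

Import Order.TTheory GRing.Theory Num.Theory.
Import numFieldNormedType.Exports.
Local Open Scope ring_scope.

(** Conditioned on there being [k] cycles, [C_I] behaves like a binomial
    variable with [m = k - 1] trials and success probability [p], up to a
    bounded factor; the theorem is then Chernoff's bound.

    Give a cycle of length [j] the weight [u j].  The total weight of the
    permutations of [n] points with [k] cycles is [n! [X^n] P^k / k!], where
    [P = \sum_(j <= n) (u j / j) X^j] ([exponential_formula]).  Differentiating
    [P^k] gives [n [X^n] P^k = k [X^n] (X P') P^(k-1)]; since the coefficients
    of [X P'] are the [u j <= M], the right-hand side is at most
    [k M P(1)^(k-1)].  Hence the factor [1/n] ([cycle_coef_le]).  With
    [u j = e^l] for [j] in [I] and [u j = 1] otherwise, [P(1)] is
    [H_n (1 - p + p e^l)], so the exponential moment of [C_I] over the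
    permutations with [k] cycles is at most a constant times
    [n!/n * H_n^m/m! * (1 - p + p e^l)^m] ([cycle_mgf_le]).

    It remains to bound the number of permutations with [k] cycles from below
    by a constant times [n!/n * H_n^m/m!].  That number is [n!/n * e_m], with
    [e_r] the [r]-th elementary symmetric function of [1, 1/2, ..., 1/(n-1)]
    ([card_ncycles]).  Newton's identities give
    [(r+2) e_(r+2) >= H_(n-1) e_(r+1) - 2 e_r], because the sum of the squares
    of these numbers is at most 2.  If [r <= A H_(n-1)] and [H_(n-1)] is large in
    terms of [A], this yields [(r+1) e_(r+1) >= (H_(n-1) - 4A) e_r]
    ([recip_esym_ratio]): each of the [O(A H_n)] steps loses a factor
    [1 - O(A / H_n)], and the total loss is bounded ([recip_esym_ge_expR]).
    If [H_(n-1)] is not large, then [m], hence [psi^2], is bounded in terms of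
    [A] and the claim is trivial.

    The constant 1/3 in the exponent is exactly what comes out of
    [e^x <= 1 + x + 3/4 x^2] for [x <= 2/3] with [l = 2 psi / (3 sqrt v)], where
    [v = p (1 - p) m]: then [3/4 l^2 v - l psi sqrt v = - psi^2 / 3], and
    [psi <= sqrt v] is what makes [l <= 2/3]. *)

(** * Orbits under multiplication by a transposition *)

Section Orbits.
Variable T : finType.
Implicit Types (s : {perm T}) (A B : {set T}) (x y z : T).

Lemma porbit_closed s x z : z \in porbit s x -> s z \in porbit s x.
Proof.
by rewrite -!eq_porbit_mem; have /= -> := porbit_perm s 1 z.
Qed.

Lemma porbit_sub s x B :
  x \in B -> (forall z, z \in B -> s z \in B) -> porbit s x \subset B.
Proof.
move=> xB sB; apply/subsetP=> z /porbitP[i ->]; rewrite permX.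
by elim: i => [|i IHi] //=; apply: sB.
Qed.

Lemma porbit_fix s x : s x = x -> porbit s x = [set x].
Proof.
move=> sx; apply/eqP; rewrite eqEsubset sub1set porbit_id andbT.
by apply: porbit_sub => [|z]; rewrite ?set11 // => /set1P->; rewrite sx set11.
Qed.

(** [orbs s A] stands in for the set of cycles of [s] on [A] when [s] is the
    identity outside [A]; [porbits s] would also contain the fixed points
    outside [A]. *)
Definition orbs s A : {set {set T}} := porbit s @: A.
Definition orbs_off s x A : {set {set T}} := orbs s A :\ porbit s x.

Lemma orbs_off_fix s x A : s x = x -> orbs_off s x A = orbs s (A :\ x).
Proof.
move=> sx; apply/setP=> c; rewrite !inE; apply/andP/imsetP.
  case=> cx /imsetP[z zA cz]; exists z => //; rewrite !inE zA andbT.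
  by apply: contraNneq cx => <-; rewrite cz.
case=> z; rewrite !inE => /andP[zx zA] ->; split; last exact: imset_f.
by rewrite eq_porbit_mem porbit_fix // inE.
Qed.

(** If [s] fixes [y], then [tperm x y * s] is [s] with [y] inserted in the
    cycle of [x], right after [x].  Every permutation [t] with [t x = y != x]
    arises once in this way, so that cycles can be built one point at a
    time. *)
Section Splice.
Variables (x y : T) (s : {perm T}).
Hypotheses (sy : s y = y) (xy : y != x).
Let t := (tperm x y * s)%g.

Let tx : t x = y. Proof. by rewrite permM tpermL. Qed.
Let ty : t y = s x. Proof. by rewrite permM tpermR. Qed.
Let tD z : z != x -> z != y -> t z = s z.
Proof. by move=> zx zy; rewrite permM tpermD // eq_sym. Qed.

Let y_notin : y \notin porbit s x.
Proof. by rewrite porbit_sym porbit_fix // inE eq_sym. Qed.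

Lemma porbit_splice : porbit t x = y |: porbit s x.
Proof.
apply/eqP; rewrite eqEsubset; apply/andP; split.
  apply: porbit_sub => [|z]; rewrite !inE ?porbit_id ?orbT //.
  have [->|zy /=] := eqVneq z y; first by rewrite ty porbit_closed ?porbit_id ?orbT.
  have [->|zx zs] := eqVneq z x; first by rewrite tx eqxx.
  by rewrite tD // porbit_closed ?orbT.
have yt : y \in porbit t x by rewrite -tx porbit_closed ?porbit_id.
rewrite subUset sub1set yt; apply: porbit_sub => [|z zt]; first exact: porbit_id.
have [->|zy] := eqVneq z y; first by rewrite sy.
have [->|zx] := eqVneq z x; first by rewrite -ty porbit_closed.
by rewrite -tD // porbit_closed.
Qed.

Lemma card_porbit_splice : #|porbit t x| = #|porbit s x|.+1.
Proof. by rewrite porbit_splice cardsU1 y_notin. Qed.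

Lemma porbit_splice_off z : z \notin porbit t x -> porbit t z = porbit s z.
Proof.
move=> zx.
have off w : w \in porbit t z -> t w = s w.
  rewrite -eq_porbit_mem => /eqP wz; apply: tD; apply: contraNneq zx => wE.
    by rewrite -eq_porbit_mem -wz wE.
  by rewrite -eq_porbit_mem -wz wE eq_porbit_mem porbit_splice setU11.
have sub : porbit s z \subset porbit t z.
  apply: porbit_sub => [|w wz]; first exact: porbit_id.
  by rewrite -off // porbit_closed.
apply/eqP; rewrite eqEsubset sub andbT; apply: porbit_sub; first exact: porbit_id.
by move=> w ws; rewrite off ?porbit_closed // (subsetP sub).
Qed.

Lemma orbs_off_splice A : orbs_off t x A = orbs_off s x (A :\ y).
Proof.
apply/setP=> c; rewrite !inE; apply/andP/andP.
  case=> cx /imsetP[z zA cz]; move: cx; rewrite cz eq_porbit_mem => zt.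
  rewrite (porbit_splice_off zt) eq_porbit_mem.
  move: zt; rewrite porbit_splice !inE negb_or => /andP[zy ->]; split=> //.
  by apply: imset_f; rewrite !inE zy.
case=> cx /imsetP[z]; rewrite !inE => /andP[zy zA] cz.
have zt : z \notin porbit t x.
  by rewrite porbit_splice !inE negb_or zy -eq_porbit_mem -cz.
by rewrite cz -(porbit_splice_off zt) eq_porbit_mem zt imset_f.
Qed.

End Splice.

Lemma perm_on_fix s x A : perm_on (A :\ x) s = perm_on A s && (s x == x).
Proof.
apply/idP/andP=> [sA|[/subsetP sA /eqP sx]].
  split; last by rewrite (out_perm sA) // !inE eqxx.
  exact: subset_trans sA (subsetDl _ _).
apply/subsetP=> z zs; rewrite !inE (sA z zs) andbT.
by apply: contraTneq zs => ->; rewrite inE /= sx eqxx.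
Qed.

Lemma perm_on_splice s x y A : x \in A -> y \in A ->
  perm_on A (tperm x y * s)%g && ((tperm x y * s)%g x == y) =
  perm_on (A :\ y) s.
Proof.
move=> xA yA; rewrite perm_on_fix permM tpermL; congr (_ && _).
have tA : perm_on A (tperm x y).
  apply: subset_trans (tperm_on x y) _.
  by apply/subsetP=> z /set2P[]->.
apply/idP/idP=> sA; last exact: perm_onM.
by have := perm_onM tA sA; rewrite mulgA tperm2 mul1g.
Qed.

(** * Weighted counts of permutations by number of cycles *)

Section WeightedCount.
Variables (R : comPzRingType) (u : nat -> R).

Definition cycle_sum k A : R :=
  \sum_(s : {perm T} | perm_on A s && (#|orbs s A| == k))
    \prod_(c in orbs s A) u #|c|.

(** The cycle through [x] is still under construction: [b] points have already
    been spliced out of it, so it counts with its final length, and it is not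
    among the [k] other cycles. *)
Definition marked_sum k b x A : R :=
  \sum_(s : {perm T} | perm_on A s && (#|orbs_off s x A| == k))
    u (#|porbit s x| + b)%N * \prod_(c in orbs_off s x A) u #|c|.

Lemma cycle_sum_marked k x A : x \in A ->
  cycle_sum k.+1 A = marked_sum k 0 x A.
Proof.
move=> xA; have xO s : porbit s x \in orbs s A by apply: imset_f.
apply: eq_big => s.
  by rewrite (cardsD1 (porbit s x)) xO.
by move=> _; rewrite (big_setD1 (porbit s x)) //= addn0.
Qed.

(** Split according to [y := s x].  If [y = x], the cycle through [x] is
    complete.  Otherwise splice [y] out of it. *)
Lemma marked_sum_rec k b x A : x \in A ->
  marked_sum k b x A = u b.+1 * cycle_sum k (A :\ x)
                       + \sum_(y in A :\ x) marked_sum k b.+1 x (A :\ y).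
Proof.
move=> xA; rewrite /marked_sum.
rewrite (partition_big (fun s : {perm T} => s x) (mem A)) /=; last first.
  by move=> s /andP[sA _]; rewrite (perm_closed _ sA).
rewrite (big_setD1 x) //=; congr (_ + _).
  rewrite /cycle_sum big_distrr /=; apply: eq_big => s.
    rewrite perm_on_fix andbAC; case: eqP => [sx|_]; rewrite ?andbF //.
    by rewrite orbs_off_fix.
  case/andP=> _ /eqP sx.
  by rewrite porbit_fix // cards1 orbs_off_fix.
apply: eq_bigr => y; rewrite !inE => /andP[yx yA].
rewrite (reindex_inj (mulgI (tperm x y))) /=; apply: eq_big => s.
  rewrite andbAC perm_on_splice //; apply: andb_id2l.
  rewrite perm_on_fix => /andP[_ /eqP sy].
  by rewrite orbs_off_splice.
rewrite andbAC perm_on_splice // => /andP[].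
rewrite perm_on_fix => /andP[_ /eqP sy] _.
by rewrite orbs_off_splice // card_porbit_splice // addSnnS.
Qed.

Lemma cycle_sum0 A : cycle_sum 0 A = (#|A| == 0)%:R.
Proof.
rewrite cards_eq0; have [->|/set0Pn[x xA]] := eqVneq A set0.
  rewrite /cycle_sum (big_pred1 1%g) => [|s].
    by rewrite /orbs imset0 big_set0.
  rewrite /orbs imset0 cards0 andbT; apply/idP/eqP=> [s0|->]; last exact: perm_on1.
  by apply: perm_on_id s0 _; rewrite cards0.
rewrite /cycle_sum big_pred0 // => s; apply/negP=> /andP[_].
by rewrite cards_eq0 => /eqP s0; have := imset_f (porbit s) xA; rewrite -/(orbs s A) s0 inE.
Qed.

Lemma cycle_sum_set0 k : cycle_sum k.+1 set0 = 0.
Proof.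
by rewrite /cycle_sum big_pred0 // => s; rewrite /orbs imset0 cards0 andbF.
Qed.

End WeightedCount.
End Orbits.

(** * The exponential formula *)

Section ExponentialFormula.
Variables (R : numFieldType) (u : nat -> R).

(** The coefficient at [j = 0] is 0, because [0^-1 = 0]. *)
Definition cycle_poly N : {poly R} := \poly_(j < N.+1) (u j / j%:R).

Definition cycle_coef N k i : R := (cycle_poly N ^+ k)`_i / k`!%:R.

Lemma cycle_coef0 N i : cycle_coef N 0 i = (i == 0)%:R.
Proof. by rewrite /cycle_coef expr0 coef1 fact0 divr1. Qed.

Lemma cycle_coefS0 N k : cycle_coef N k.+1 0 = 0.
Proof.
rewrite /cycle_coef exprS coefM big_ord_recl big_ord0 coef_poly /=.
by rewrite invr0 !(mulr0, mul0r, addr0).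
Qed.

(** The coefficient of [X^i] in [(P^(k+1))' = (k+1) P' P^k], the [j]-th
    coefficient of [P'] being [u j.+1]. *)
Lemma cycle_coefSS N k i : (i < N)%N ->
  i.+1%:R * cycle_coef N k.+1 i.+1 = \sum_(j < i.+1) u j.+1 * cycle_coef N k (i - j).
Proof.
move=> iN; rewrite /cycle_coef factS natrM.
have := coef_deriv (cycle_poly N ^+ k.+1) i.
rewrite deriv_exp /= coefMn coefM => E.
have k0 : k.+1%:R != 0 :> R by rewrite pnatr_eq0.
rewrite mulrA mulr_natl -E -[(\sum_(_ < _) _) *+ _]mulr_natr invfM mulrA mulfK //.
rewrite mulr_suml; apply: eq_bigr => j _; rewrite coef_deriv coef_poly.
rewrite ltnS (leq_trans (ltn_ord j)) // -[_ / _ *+ _]mulr_natr mulfVK ?pnatr_eq0 //.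
by rewrite mulrA.
Qed.

End ExponentialFormula.

Section Count.
Variables (R : numFieldType) (u : nat -> R) (T : finType) (N : nat).
Implicit Types (A : {set T}) (x : T).

Let formula_at k := forall A, (#|A| <= N)%N ->
  cycle_sum u k A = #|A|`!%:R * cycle_coef u N k #|A|.

(** Unrolling [marked_sum_rec]: after [j] splices there are
    [n (n-1) ... (n-j+1)] choices for the spliced points, and the
    other [n - j] points carry a permutation with [k] cycles.  The factor
    [(n - j)!] from [formula_at] completes the product to [n!]. *)
Lemma marked_sumE k n b x A : formula_at k -> (n < N)%N -> x \in A -> #|A| = n.+1 ->
  marked_sum u k b x A
  = n`!%:R * \sum_(j < n.+1) u (b + j).+1 * cycle_coef u N k (n - j).
Proof.
move=> Dk; elim: n b A => [|n IHn] b A nN xA cA; rewrite marked_sum_rec //.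
all: have cAD y : y \in A -> #|A :\ y| = #|A|.-1
  by move=> yA; rewrite (cardsD1 y A) yA.
  have A0 : A :\ x = set0 by apply/eqP; rewrite -cards_eq0 cAD // cA.
  by rewrite A0 big_set0 Dk ?cards0 // fact0 big_ord_recl big_ord0 subn0 addn0 !addr0 !mul1r.
rewrite Dk cAD // cA //=; last exact: ltnW.
rewrite (eq_bigr (fun=> n`!%:R *
  \sum_(j < n.+1) u (b.+1 + j).+1 * cycle_coef u N k (n - j))) => [|y]; last first.
  rewrite !inE => /andP[yx yA]; apply: IHn; first exact: ltnW.
    by rewrite !inE eq_sym yx.
  by rewrite cAD // cA.
rewrite big_const iter_addr addr0 cAD // cA /=.
rewrite [in RHS]big_ord_recl addn0 subn0 mulrDr mulrCA; congr (_ + _).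
rewrite -[LHS]mulr_natl mulrA -natrM -factS; congr (_ * _).
by apply: eq_bigr => j _; rewrite /= addnS addSn subSS.
Qed.

(** Removing the cycle of one point of [A], as [marked_sumE] does with [b = 0],
    gives the recursion of [cycle_coefSS] for the coefficients of [P^k / k!]. *)
Lemma cycle_sumE k A : (#|A| <= N)%N ->
  cycle_sum u k A = #|A|`!%:R * cycle_coef u N k #|A|.
Proof.
elim: k A => [|k IHk] A AN.
  rewrite cycle_sum0 cycle_coef0; case: eqP => [->|_]; last by rewrite mulr0.
  by rewrite fact0 mulr1.
have [->|/set0Pn[x xA]] := eqVneq A set0.
  by rewrite cycle_sum_set0 cards0 cycle_coefS0 mulr0.
have [n cA] : exists n, #|A| = n.+1 by exists #|A|.-1; rewrite (cardsD1 x A) xA.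
rewrite (cycle_sum_marked _ _ xA) cA in AN *.
rewrite (marked_sumE _ IHk AN xA cA) factS mulnC natrM -mulrA.
by rewrite cycle_coefSS.
Qed.
End Count.

Lemma exponential_formula (R : numFieldType) (u : nat -> R) n k :
  \sum_(s : 'S_n | ncycles s == k) \prod_(c in porbits s) u #|c|
  = n`!%:R * cycle_coef u n k n.
Proof.
have := cycle_sumE (T := 'I_n) u k (A := setT).
rewrite cardsT card_ord => /(_ n (leqnn n)) <-; rewrite /cycle_sum.
have oE s : orbs s setT = porbits s :> {set {set 'I_n}}.
  by apply/setP=> c; apply/imsetP/imsetP=> -[z _ ->]; exists z; rewrite ?inE.
apply: eq_big => s; last by rewrite oE.
rewrite oE /ncycles; suff -> : perm_on [set: 'I_n] s by [].
by apply/subsetP=> z; rewrite inE.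
Qed.

(** * An upper bound for weighted counts *)

Lemma sum_coef_le_horner1 (R : numDomainType) (p : {poly R}) m :
  (forall i, 0 <= p`_i) -> \sum_(i < m) p`_i <= p.[1].
Proof.
move=> p0; rewrite (horner_coef_wide _ (leq_maxr m (size p))).
rewrite (big_ord_widen (maxn m (size p)) (fun i => p`_i) (leq_maxl _ _)).
rewrite big_mkcond; apply: ler_sum => i _; rewrite expr1n mulr1.
by case: ifP.
Qed.

Section Upper.
Variables (R : numFieldType) (u : nat -> R) (M : R).
Hypotheses (u0 : forall j, 0 <= u j) (uM : forall j, u j <= M).

Lemma cycle_coef_ge0 N k i : 0 <= cycle_coef u N k i.
Proof.
rewrite /cycle_coef divr_ge0 //; elim: k i => [|k IHk] i.
  by rewrite expr0 coef1 ler0n.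
rewrite exprS coefM sumr_ge0 // => j _; rewrite mulr_ge0 // coef_poly.
by case: ifP => // _; rewrite divr_ge0.
Qed.

(** With [P := cycle_poly u n], [cycle_coefSS] bounds [n] times the left-hand
    side by [M] times a partial sum of the coefficients of [P^k / k!], which
    is at most the value of that polynomial at 1. *)
Lemma cycle_coef_le n k : (0 < n)%N ->
  cycle_coef u n k.+1 n <= M / n%:R * ((\sum_(j < n.+1) u j / j%:R) ^+ k / k`!%:R).
Proof.
case: n => // i _; have M0 : 0 <= M by apply: le_trans (uM 0).
have i0 : 0 < i.+1%:R :> R by rewrite ltr0n.
rewrite mulrAC ler_pdivlMr // mulrC cycle_coefSS //.
apply: (@le_trans _ _ (M * \sum_(j < i.+1) cycle_coef u i.+1 k j)).
  rewrite mulr_sumr [leRHS](reindex_inj rev_ord_inj) /=; apply: ler_sum => j _.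
  by rewrite subSS ler_wpM2r ?cycle_coef_ge0.
apply: ler_wpM2l => //; rewrite -mulr_suml ler_wpM2r ?invr_ge0 //.
have := @sum_coef_le_horner1 R (cycle_poly u i.+1 ^+ k) i.+1.
rewrite horner_exp horner_poly => P1; apply: le_trans (P1 _) _.
  move=> j; have := cycle_coef_ge0 i.+1 k j.
  by rewrite /cycle_coef pmulr_lge0 // invr_gt0 ltr0n fact_gt0.
by under eq_bigr do rewrite expr1n mulr1.
Qed.
End Upper.

(** * Elementary symmetric functions of 1, 1/2, ..., 1/m *)

Section Lower.
Variable R : realType.

(** The [r]-th elementary symmetric function of [1, 1/2, ..., 1/m]. *)
Fixpoint recip_esym (m r : nat) : R :=
  match m, r with
  | _, 0 => 1
  | 0, _.+1 => 0
  | m'.+1, r'.+1 => recip_esym m' r + recip_esym m' r' / m%:R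
  end.

Lemma recip_esym0 m : recip_esym m 0 = 1. Proof. by case: m. Qed.

Lemma recip_esymSS m r :
  recip_esym m.+1 r.+1 = recip_esym m r.+1 + recip_esym m r / m.+1%:R.
Proof. by []. Qed.

(** Both sides satisfy the same recursion: for unit weights, [cycle_coefSS]
    says that the term [i = m + 1] is the sum up to [m] for [r - 1], divided by
    [m + 1]. *)
Lemma sum_cycle_coef1 N m r : (m <= N)%N ->
  \sum_(i < m.+1) cycle_coef (fun=> 1) N r i = recip_esym m r.
Proof.
elim: m r => [|m IHm] r mN.
  by rewrite big_ord_recl big_ord0 addr0; case: r => [|r];
    rewrite ?cycle_coef0 // cycle_coefS0.
rewrite big_ord_recr /= IHm; last exact: ltnW.
case: r => [|r]; first by rewrite cycle_coef0 addr0 recip_esym0.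
congr (_ + _); apply: (@mulfI _ m.+1%:R); first by rewrite pnatr_eq0.
rewrite cycle_coefSS // mulrCA divff ?pnatr_eq0 // mulr1 -IHm; last exact: ltnW.
rewrite [RHS](reindex_inj rev_ord_inj); apply: eq_bigr => j _.
by rewrite mul1r /= subSS.
Qed.

Lemma cycle_coef1E n k :
  cycle_coef (fun=> 1) n.+1 k.+1 n.+1 = recip_esym n k / n.+1%:R.
Proof.
have := @sum_cycle_coef1 n.+1 n.+1 k.+1 (leqnn _).
by rewrite big_ord_recr /= sum_cycle_coef1 // => /addrI.
Qed.

Lemma recip_esym_ge0 m r : 0 <= recip_esym m r.
Proof.
elim: m r => [|m IHm] [|r] //; rewrite ?recip_esym0 //.
by rewrite recip_esymSS addr_ge0 ?divr_ge0.
Qed.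

Lemma harm0 : harm R 0 = 0.
Proof. by rewrite /harm big_geq. Qed.

Lemma harmS m : harm R m.+1 = harm R m + m.+1%:R^-1.
Proof. by rewrite /harm big_nat_recr. Qed.

Lemma harm_ge0 m : 0 <= harm R m.
Proof. by elim: m => [|m IHm]; [rewrite harm0 | rewrite harmS addr_ge0 ?invr_ge0]. Qed.

Lemma recip_esym1 m : recip_esym m 1 = harm R m.
Proof.
elim: m => [|m IHm]; first by rewrite harm0.
by rewrite recip_esymSS IHm recip_esym0 harmS mul1r.
Qed.

Definition harm2 m : R := \sum_(i < m) i.+1%:R^-1 ^+ 2.

Lemma harm2_le2 m : harm2 m <= 2.
Proof.
have H k : harm2 k.+1 <= 2 - k.+1%:R^-1.
  elim: k => [|k IHk]; first by rewrite /harm2 big_ord_recl big_ord0 /=; lra.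
  rewrite /harm2 big_ord_recr /=; apply: le_trans (lerD IHk (lexx _)) _.
  have a0 : 0 < k.+1%:R :> R by rewrite ltr0n.
  have b0 : k.+2%:R = k.+1%:R + 1 :> R by rewrite natr1.
  rewrite b0; set a : R := k.+1%:R in a0 *.
  have -> : 2 - (a + 1)^-1 = 2 - a^-1 + (a + 1)^-1 ^+ 2 + a^-1 * (a + 1)^-1 ^+ 2.
    by field; rewrite !gt_eqF //; lra.
  by rewrite lerDl mulr_ge0 ?sqr_ge0 // invr_ge0 ltW.
case: m => [|m]; first by rewrite /harm2 big_ord0.
by apply: le_trans (H m) _; rewrite gerBl invr_ge0.
Qed.

(** In Newton's expansion of [(r+2) e_(r+2)] by power sums the first two terms
    are those on the left, and truncating there gives a lower bound, the
    [1/i] being positive.  The inequality survives the step from [m] to [m + 1],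
    which replaces [e_r] by [e_r + e_(r-1) / (m + 1)]. *)
Lemma newton_recip m r :
  harm R m * recip_esym m r.+1 - harm2 m * recip_esym m r
    <= r.+2%:R * recip_esym m r.+2.
Proof.
elim: m r => [|m IHm] r; first by rewrite harm0 /harm2 big_ord0 /= !(mul0r, mulr0, subr0).
rewrite harmS /harm2 big_ord_recr /= -/(harm2 m).
set h := m.+1%:R^-1; have h0 : 0 <= h by rewrite invr_ge0.
have b0 : 0 <= harm2 m by apply: sumr_ge0 => i _; rewrite sqr_ge0.
have r2 : r.+2%:R = r%:R + 2 :> R by rewrite -natrD addn2.
have IH2 := IHm r; rewrite r2 in IH2 *.
have e0 := recip_esym_ge0 m.
(* For [r = 0] there is no [e_(r-1)], and [recip_esym1] is used instead. *)
case: r r2 IH2 => [|r] r2 IH2.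
  rewrite recip_esym0 recip_esym1 in IH2 *.
  have := e0 2; have := harm_ge0 m.
  set E2 := recip_esym m 2; set H := harm R m; move: IH2.
  rewrite -/E2 -/H; nra.
have := IHm r; have r1 : r.+2%:R = r.+1%:R + 1 :> R by rewrite natr1.
rewrite r1 => IH1.
have := ler_wpM2r h0 IH1.
have := mulr_ge0 (e0 r) (exprn_ge0 3 h0).
move: IH2; rewrite /= -/h.
set E0 := recip_esym m r; set E1 := recip_esym m r.+1; set E2 := recip_esym m r.+2.
set E3 := recip_esym m r.+3.
set H := harm R m; set B := harm2 m; nra.
Qed.
End Lower.

(** * A lower bound for the number of permutations with given number of cycles *)

Section LowerBound.
Variable R : realType.
Implicit Types a b : R.

(** The inequality at [r] gives [e_r <= 2 (r+1) / S * e_(r+1) <= 2 a e_(r+1)],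
    where [S = harm R m], since [S - 4 a >= S / 2].  Hence the loss [2 e_r] in
    Newton's inequality is at most [4 a e_(r+1)], which is the inequality at
    [r + 1]. *)
Lemma recip_esym_ratio m a r : 8 * a <= harm R m -> 0 < a ->
  r.+1%:R <= a * harm R m ->
  (harm R m - 4 * a) * recip_esym R m r <= r.+1%:R * recip_esym R m r.+1.
Proof.
set S := harm R m => aS a0; have S0 : 0 < S by lra.
elim: r => [|r IHr] rS.
  rewrite recip_esym0 recip_esym1 -/S; lra.
have r2 : r.+2%:R = r.+1%:R + 1 :> R by rewrite natr1.
have {IHr} IH : (S - 4 * a) * recip_esym R m r <= r.+1%:R * recip_esym R m r.+1.
  by apply: IHr; apply: le_trans rS; rewrite ler_nat.
apply: le_trans (newton_recip R m r).
have h2 := harm2_le2 R m.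
have e0 := recip_esym_ge0 R m r; have e1 := recip_esym_ge0 R m r.+1.
rewrite -/S mulrBl lerB //; apply: (@le_trans _ _ (2 * recip_esym R m r)).
  exact: ler_wpM2r.
rewrite -(ler_pM2l S0).
have : S * recip_esym R m r <= 2 * (S - 4 * a) * recip_esym R m r.
  by rewrite ler_wpM2r //; lra.
have : r.+1%:R * recip_esym R m r.+1 <= a * S * recip_esym R m r.+1.
  by rewrite ler_wpM2r //; apply: le_trans rS; rewrite ler_nat.
move: IH; set E0 := recip_esym R m r; set E1 := recip_esym R m r.+1.
set n := r.+1%:R; lra.
Qed.

Lemma recip_esym_ge m a r : 8 * a <= harm R m -> 0 < a ->
  r%:R <= a * harm R m ->
  (harm R m - 4 * a) ^+ r <= r`!%:R * recip_esym R m r.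
Proof.
move=> aS a0; elim: r => [|r IHr] rS; first by rewrite recip_esym0 fact0 mulr1.
have S4 : 0 <= harm R m - 4 * a by lra.
rewrite exprS factS natrM mulrAC [leRHS]mulrC.
apply: (@le_trans _ _ ((harm R m - 4 * a) * (r`!%:R * recip_esym R m r))).
  by apply: ler_wpM2l => //; apply: IHr; apply: le_trans rS; rewrite ler_nat.
by rewrite mulrCA ler_wpM2l // recip_esym_ratio.
Qed.

(** [1 - x >= e^(-2x)] for [0 <= x <= 1/2], applied to [x = b / H]. *)
Lemma expR_pow_sub a b (H : R) r : 0 <= b -> 2 * b <= H -> 0 < H ->
  r%:R <= a * H -> expR (- (2 * a * b)) * H ^+ r <= (H - b) ^+ r.
Proof.
move=> b0 bH H0 rH; set x := b / H.
have x0 : 0 <= x by rewrite divr_ge0 // ltW.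
have x1 : x <= 2^-1 by rewrite ler_pdivrMr //; lra.
have -> : H - b = H * (1 - x) by rewrite /x; field; rewrite gt_eqF.
rewrite exprMn mulrC ler_wpM2l ?exprn_ge0 ?(ltW H0) //.
apply: (@le_trans _ _ (expR (- (2 * x)) ^+ r)); last first.
  apply: lerXn2r; rewrite ?nnegrE ?expR_ge0 //; first lra.
  rewrite expRN -[leRHS]invrK lef_pV2 ?posrE ?expR_gt0 ?invr_gt0 //; last lra.
  apply: le_trans (expR_ge1Dx _).
  rewrite -[_^-1]mul1r ler_pdivrMr; last lra.
  nra.
rewrite -expRM_natl ler_expR mulrN lerN2 mulrCA -mulrA ler_wpM2l //.
by rewrite /x mulrA ler_pdivrMr // mulrAC ler_wpM2r.
Qed.

Lemma ln_le_harm m : ln m.+1%:R <= harm R m.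
Proof.
elim: m => [|m IHm]; first by rewrite ln1 harm0.
have m0 : 0 < m.+1%:R :> R by rewrite ltr0n.
have -> : m.+2%:R = m.+1%:R * (1 + m.+1%:R^-1) :> R.
  by rewrite mulrDr mulr1 divff ?gt_eqF // natr1.
have i0 : 0 < m.+1%:R^-1 :> R by rewrite invr_gt0.
rewrite lnM ?posrE //; last by rewrite addr_gt0.
by rewrite harmS lerD // le_ln1Dx // (lt_trans _ i0) // ltrN10.
Qed.

Lemma recip_esym_ge_expR a m r : 1 < a -> 8 * a + 2 <= harm R m ->
  r.+1%:R <= a * ln (m.+1%:R : R) ->
  expR (- (2 * a * (4 * a + 1))) * harm R m.+1 ^+ r <= r`!%:R * recip_esym R m r.
Proof.
move=> a1 aS rl; have lS := ln_le_harm m.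
have rS : r%:R <= a * harm R m.
  apply: (@le_trans _ _ r.+1%:R); first by rewrite ler_nat.
  by apply: le_trans rl _; rewrite ler_wpM2l //; lra.
have i0 : 0 <= m.+1%:R^-1 :> R by rewrite invr_ge0.
have i1 : m.+1%:R^-1 <= 1 :> R by rewrite invf_le1 ?ler1n ?ltr0n.
apply: le_trans (recip_esym_ge _ _ rS); [|lra|lra].
have := harmS R m; set i := m.+1%:R^-1 in i0 i1 *; move=> HS.
apply: le_trans (expR_pow_sub _ _ _ _) _; rewrite ?HS; [lra|lra|lra| |].
  by apply: le_trans rS _; rewrite ler_wpM2l //; lra.
by apply: lerXn2r; rewrite ?nnegrE; lra.
Qed.
End LowerBound.

(** * Exponential moments *)

Section Chernoff.
Variable R : realType.

(** [(1 + y + 3/4 y^2) e^(-y)] equals 1 at 0, and its derivative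
    [e^(-y) y/2 (1 - 3/2 y)] has the sign of [y] for [y <= 2/3]. *)
Lemma expR_le_quad (x : R) : x <= 2 / 3 -> expR x <= 1 + x + 3 / 4 * x ^+ 2.
Proof.
pose f (y : R) : R := (1 + y + 3 / 4 * y ^+ 2) * expR (- y).
pose df (y : R) : R := expR (- y) * (y / 2 * (1 - 3 / 2 * y)).
have Df (y : R) : is_derive y (1 : R) f (df y).
  rewrite /f /df; apply: is_derive_eq.
  by rewrite /GRing.scale /=; field.
have cf : continuous f.
  by move=> z; apply: differentiable_continuous; apply/derivable1_diffP; have [] := Df z.
have f0 : f 0 = 1 by rewrite /f oppr0 expR0; field.
move=> x23; suff : 1 <= f x.
  by rewrite /f expRN ler_pdivlMr ?expR_gt0 // mul1r.
rewrite -subr_ge0 -f0; have [x0|x0|->] := ltgtP x 0; last by rewrite subrr.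
  have [c] := MVT x0 (fun y _ => Df y) (continuous_subspaceT cf); rewrite in_itv /= => /andP[cx c0] E.
  rewrite -opprB E oppr_ge0 mulr_le0_ge0 ?subr_ge0 ?(ltW x0) //.
  by rewrite /df pmulr_rle0 ?expR_gt0 //; nra.
have [c] := MVT x0 (fun y _ => Df y) (continuous_subspaceT cf); rewrite in_itv /= => /andP[c0 cx] E.
rewrite E mulr_ge0 //; last lra.
by rewrite /df pmulr_rge0 ?expR_gt0 //; nra.
Qed.

(** Apply [expR_le_quad] to the two values of the centred variable: the linear
    terms cancel, and the quadratic ones add up to the variance. *)
Lemma bernoulli_mgf (p l : R) : 0 <= p <= 1 -> `|l| <= 2 / 3 ->
  1 - p + p * expR l <= expR (p * l + 3 / 4 * l ^+ 2 * (p * (1 - p))).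
Proof.
move=> /andP[p0 p1] l23; rewrite expRD.
have lq (q : R) : 0 <= q <= 1 -> `|q * l| <= 2 / 3.
  move=> /andP[q0 q1]; rewrite normrM (ger0_norm q0).
  by apply: le_trans l23; rewrite ler_piMl.
have lp := lq p; have lp' := lq (1 - p).
have -> : 1 - p + p * expR l
  = expR (p * l) * ((1 - p) * expR (- (p * l)) + p * expR ((1 - p) * l)).
  rewrite mulrDr mulrCA -expRD subrr expR0 mulr1 mulrCA -expRD.
  by congr (_ + _ * expR _); ring.
rewrite ler_wpM2l ?expR_ge0 //.
apply: le_trans (expR_ge1Dx _).
have h1 : expR (- (p * l)) <= 1 - p * l + 3 / 4 * (p * l) ^+ 2.
  rewrite -(sqrrN (p * l)) expR_le_quad //.
  by apply: le_trans (ler_norm _) _; rewrite normrN lp // p0.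
have h2 : expR ((1 - p) * l) <= 1 + (1 - p) * l + 3 / 4 * ((1 - p) * l) ^+ 2.
  rewrite expR_le_quad //; apply: le_trans (ler_norm _) _; rewrite lp' //; lra.
have q0 : 0 <= 1 - p by lra.
apply: le_trans (lerD (ler_wpM2l q0 h1) (ler_wpM2l p0 h2)) _.
rewrite le_eqVlt; apply/orP; left; apply/eqP; ring.
Qed.
End Chernoff.

Section MGF.
Variable R : realType.

Definition weight n (I : {set 'I_n.+1}) (l : R) (j : nat) : R :=
  if [exists i in I, j == i :> nat] then expR l else 1.

Lemma prod_weight n (I : {set 'I_n.+1}) l (s : 'S_n) :
  \prod_(c in porbits s) weight I l #|c| = expR (l * (ncycles_in I s)%:R).
Proof.
rewrite mulrC expRM_natl /ncycles_in -big_mkcondr -prodr_const.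
by apply: eq_bigl => c; rewrite inE.
Qed.

Lemma sum_weight n (I : {set 'I_n.+1}) l :
  \sum_(j < n.+1) weight I l j / j%:R = harm R n + (expR l - 1) * harm_set R I.
Proof.
have -> : harm R n = \sum_(j < n.+1) (j : nat)%:R^-1.
  by rewrite /harm big_add1 big_mkord big_ord_recl invr0 add0r.
rewrite /harm_set mulr_sumr [in RHS](big_mkcond (mem I)) -big_split /=.
apply: eq_bigr => j _; rewrite /weight.
have -> : [exists i in I, (j : nat) == i :> nat] = (j \in I).
  apply/existsP/idP => [[i /andP[iI /eqP ji]]|jI]; last by exists j; rewrite jI /=.
  by rewrite (val_inj ji).
case: ifP => _; last by rewrite mul1r addr0.
by rewrite mulrBl mul1r addrC subrK.
Qed.

(** [P(1)] is [H_n] times the exponential moment of a Bernoulli variable, and the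
    weights are at most 2 because [e^(2/3) <= 2]. *)
Lemma cycle_mgf_le n (I : {set 'I_n.+1}) r l :
  let p := harm_set R I / harm R n in
  (0 < n)%N -> 0 <= p <= 1 -> `|l| <= 2 / 3 ->
  \sum_(s : 'S_n | ncycles s == r.+1) expR (l * (ncycles_in I s)%:R)
  <= n`!%:R * (2 / n%:R * (harm R n ^+ r / r`!%:R))
     * expR (p * r%:R * l + 3 / 4 * l ^+ 2 * (p * (1 - p) * r%:R)).
Proof.
move=> p n0 p01 l23; under eq_bigr do rewrite -prod_weight.
have l2 : l <= 2 / 3 by apply: le_trans (ler_norm l) l23.
have e2 : expR l <= 2 by have := expR_le_quad l2; move: l23; rewrite ler_norml; nra.
have u0 j : 0 <= weight I l j by rewrite /weight; case: ifP; rewrite ?expR_ge0.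
have u2 j : weight I l j <= 2 by rewrite /weight; case: ifP => // _; lra.
have H0 : 0 < harm R n.
  by case: n n0 {I p p01 u0 u2} => // n _; rewrite harmS ltr_wpDl ?harm_ge0 // invr_gt0.
rewrite exponential_formula -mulrA ler_wpM2l //.
apply: le_trans (cycle_coef_le u0 u2 _ n0) _.
rewrite -[leRHS]mulrA ler_wpM2l ?divr_ge0 // [leRHS]mulrAC ler_wpM2r ?invr_ge0 //.
have -> : \sum_(j < n.+1) weight I l j / j%:R = harm R n * (1 - p + p * expR l).
  by rewrite sum_weight /p; field; rewrite gt_eqF.
rewrite exprMn ler_wpM2l ?exprn_ge0 ?(ltW H0) //.
have -> : p * r%:R * l + 3 / 4 * l ^+ 2 * (p * (1 - p) * r%:R)
  = r%:R * (p * l + 3 / 4 * l ^+ 2 * (p * (1 - p))) by ring.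
have /andP[p0 p1] := p01.
rewrite expRM_natl; apply: lerXn2r; rewrite ?nnegrE ?expR_ge0 ?bernoulli_mgf //.
by rewrite addr_ge0 ?subr_ge0 // mulr_ge0 ?expR_ge0.
Qed.

(** * The conditional tail bound *)

Lemma card_ncycles n r : (#|[set s : 'S_n.+1 | ncycles s == r.+1]|%:R : R)
  = n.+1`!%:R * (recip_esym R n r / n.+1%:R).
Proof.
rewrite -cycle_coef1E -exponential_formula cardsE -sum1_card natr_sum.
by apply: eq_bigr => s _; rewrite big1.
Qed.

(** The two-sided Markov bound: whichever sign [x] has, one of the two
    exponentials is at least [e^(l t)]. *)
Lemma indicator_le_exp (x t l : R) : 0 <= l -> t <= `|x| ->
  1 <= expR (- (l * t)) * (expR (l * x) + expR (- (l * x))).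
Proof.
move=> l0 tx; apply: (@le_trans _ _ (expR (- (l * t)) * expR (l * `|x|))).
  rewrite -expRD -expR0 ler_expR addrC subr_ge0; exact: ler_wpM2l.
rewrite ler_wpM2l ?expR_ge0 //; case: (ger0P x) => _; last rewrite mulrN.
  by rewrite lerDl expR_ge0.
by rewrite lerDr expR_ge0.
Qed.

Lemma cond_probE n (E F : {set 'S_n}) :
  cond_prob R E F = #|E :&: F|%:R / #|F|%:R.
Proof.
rewrite /cond_prob /prob cardsT card_Sn invf_div mulrA divfK //.
by rewrite pnatr_eq0 -lt0n fact_gt0.
Qed.

Lemma cond_prob_le1 n (E F : {set 'S_n}) : cond_prob R E F <= 1.
Proof.
rewrite cond_probE; have [->|F0] := eqVneq F set0.
  by rewrite setI0 cards0 mul0r.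
by rewrite ler_pdivrMr ?ltr0n ?card_gt0 // mul1r ler_nat subset_leq_card ?subsetIr.
Qed.

Lemma card_ncycles_ge (a : R) n r : 1 < a -> 8 * a + 2 <= harm R n ->
  r.+1%:R <= a * ln (n.+1%:R : R) ->
  n.+1`!%:R / n.+1%:R * (harm R n.+1 ^+ r / r`!%:R)
  <= expR (2 * a * (4 * a + 1)) * #|[set s : 'S_n.+1 | ncycles s == r.+1]|%:R.
Proof.
move=> a1 aH ra; have := recip_esym_ge_expR a1 aH ra.
rewrite card_ncycles; set e := recip_esym _ _ _; set C := 2 * a * _ => L.
have -> : expR C * (n.+1`!%:R * (e / n.+1%:R)) = n.+1`!%:R / n.+1%:R * (expR C * e).
  by ring.
rewrite ler_wpM2l ?divr_ge0 // ler_pdivrMr ?ltr0n ?fact_gt0 //.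
move: L; rewrite expRN mulrC ler_pdivrMr ?expR_gt0 //.
by rewrite [_ * e]mulrC [leRHS]mulrC mulrA.
Qed.
End MGF.

Theorem theorem1p14 (R : realType) (A : R) (hA : 1 < A) :
  exists2 K : R, 0 < K &
  forall (n : nat) (I : {set 'I_n.+1}) (k : nat) (psi : R),
    (2 <= n)%N ->
    I != set0 ->
    I \proper brack n ->
    harm_set R I <= 2^-1 * harm R n ->
    (2 <= k)%N ->
    k%:R <= A * ln (n%:R : R) ->
    (k <= n)%N ->
    let p : R := harm_set R I / harm R n in
    let m : R := k%:R - 1 in
    0 <= psi ->
    psi <= Num.sqrt (p * (1 - p) * m) ->
    cond_prob R
      [set s : 'S_n |
        psi * Num.sqrt (p * (1 - p) * m) <= `|(ncycles_in I s)%:R - p * m|]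
      [set s : 'S_n | ncycles s == k]
    <= K * expR (- (3^-1 * psi ^+ 2)).
Proof.
(* 4 = 2 * 2: the two tails, and the bound [expR l <= 2] on the weights. *)
exists (4 * expR (2 * A * (4 * A + 1))); first by rewrite mulr_gt0 ?expR_gt0.
move=> [|n] // I [|r] // psi n2 I0 /andP[Isub _] Ip r1 kA kn p m psi0 psiv.
have mr : m = r%:R by rewrite /m -natr1 addrK.
have m1 : 1 <= m by rewrite mr ler1n.
have H0 : 0 < harm R n.+1.
  by rewrite harmS ltr_wpDl ?harm_ge0 // invr_gt0.
have p0 : 0 < p.
  rewrite divr_gt0 //; have /set0Pn[j jI] := I0.
  have j0 : (0 < j)%N by have := subsetP Isub _ jI; rewrite inE.
  rewrite /harm_set (bigD1 j) //= ltr_pwDl ?invr_gt0 ?ltr0n //.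
  by apply: sumr_ge0 => i _; rewrite invr_ge0.
have p2 : p <= 2^-1 by rewrite ler_pdivrMr.
have pE : harm_set R I / harm R n.+1 = p by [].
have mE : r.+1%:R = m + 1 by rewrite /m subrK.
clearbody p m.
set v := p * (1 - p) * m in psiv *; set w := Num.sqrt v in psiv *.
have v0 : 0 < v by rewrite !mulr_gt0 //; lra.
have w0 : 0 < w by rewrite sqrtr_gt0.
have wv : w ^+ 2 = v by rewrite sqr_sqrtr // ltW.
set E := [set s | _]; set F := [set s | _].
have [Sbig|Ssmall] := lerP (8 * A + 2) (harm R n); last first.
  (* Then [psi ^+ 2 <= m] is bounded in terms of [A], and the right-hand side is
     at least 1. *)
  apply: (le_trans (cond_prob_le1 _ _ _)).
  have k1 : m <= A * (8 * A + 2).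
    have := ln_le_harm R n; have := kA; rewrite mE; nra.
  have psi2 : psi ^+ 2 <= v by rewrite -wv; apply: lerXn2r; rewrite ?nnegrE ?(ltW w0).
  have vm : v <= m by rewrite /v ler_piMl //; [lra|nra].
  rewrite -mulrA -expRD; set x := (X in expR X).
  have x0 : 0 <= x by rewrite /x; nra.
  have := expR_ge1Dx x; lra.
have Fge := card_ncycles_ge hA Sbig kA; rewrite -/F in Fge.
(* The minimizer of [3/4 l^2 v - l psi w]. *)
pose l := 2 / 3 * psi / w.
have l0 : 0 <= l by rewrite !mulr_ge0 // ?invr_ge0 ?ltW.
have l23 : l <= 2 / 3.
  have : psi / w <= 1 by rewrite ler_pdivrMr // mul1r.
  by rewrite /l -[2 / 3 * psi / w]mulrA; set q := psi / w; lra.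
pose Y s : R := (ncycles_in I s)%:R - p * m.
have EF : #|E :&: F|%:R <= \sum_(s : 'S_n.+1 | ncycles s == r.+1)
   expR (- (l * (psi * w))) * (expR (l * Y s) + expR (- (l * Y s))).
  rewrite -sum1_card natr_sum big_mkcond [leRHS]big_mkcond /=.
  apply: ler_sum => s _; rewrite !inE; case: (ncycles s == _); rewrite ?andbF //= andbT.
  case: ifP => [/indicator_le_exp|_]; first exact.
  by rewrite mulr_ge0 ?addr_ge0 ?expR_ge0.
have half l' : `|l'| = l -> \sum_(s : 'S_n.+1 | ncycles s == r.+1) expR (l' * Y s)
    <= 2 * expR (3^-1 * psi ^+ 2) * (n.+1`!%:R / n.+1%:R * (harm R n.+1 ^+ r / r`!%:R)).
  move=> ll; have p01 : 0 <= p <= 1 by rewrite ltW //=; lra.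
  have ll23 : `|l'| <= 2 / 3 by rewrite ll.
  rewrite -pE in p01; have := cycle_mgf_le r (ltn0Sn n) p01 ll23.
  have l2 : l' ^+ 2 = l ^+ 2 by rewrite -ll -normrX ger0_norm ?sqr_ge0.
  rewrite pE expRD l2 -mr => Z.
  have -> : \sum_(s : 'S_n.+1 | ncycles s == r.+1) expR (l' * Y s)
    = expR (- (p * m * l')) *
      \sum_(s : 'S_n.+1 | ncycles s == r.+1) expR (l' * (ncycles_in I s)%:R).
    rewrite mulr_sumr; apply: eq_bigr => s _; rewrite -expRD /Y.
    by congr expR; ring.
  apply: le_trans (ler_wpM2l (expR_ge0 _) Z) _.
  have -> : 3 / 4 * l ^+ 2 * (p * (1 - p) * m) = 3^-1 * psi ^+ 2.
    rewrite -/v -wv /l; field; exact: lt0r_neq0.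
  have -> : n.+1`!%:R * (2 / n.+1%:R * (harm R n.+1 ^+ r / r`!%:R))
    = 2 * (n.+1`!%:R / n.+1%:R * (harm R n.+1 ^+ r / r`!%:R)) by ring.
  set G := expR (p * m * l'); set X := expR (3^-1 * _); set B := _ / _ * _.
  have -> : expR (- (p * m * l')) * (2 * B * (G * X)) = 2 * X * B * (expR (- (p * m * l')) * G).
    by ring.
  by rewrite -expRD addNr expR0 mulr1.
have lN : `|- l| = l by rewrite normrN ger0_norm.
have Fpos : 0 < #|F|%:R :> R.
  rewrite -(pmulr_rgt0 _ (expR_gt0 (2 * A * (4 * A + 1)))); apply: lt_le_trans Fge.
  by rewrite mulr_gt0 ?divr_gt0 ?exprn_gt0 ?ltr0n ?fact_gt0.
rewrite cond_probE ler_pdivrMr //; apply: le_trans EF _; rewrite -mulr_sumr.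
set X := expR (3^-1 * psi ^+ 2) in half; set C := expR (2 * A * _) in Fge *.
have sum_le : \sum_(s : 'S_n.+1 | ncycles s == r.+1) (expR (l * Y s) + expR (- (l * Y s)))
    <= 4 * X * (C * #|F|%:R).
  rewrite big_split /=.
  have -> : \sum_(s : 'S_n.+1 | ncycles s == r.+1) expR (- (l * Y s))
      = \sum_(s : 'S_n.+1 | ncycles s == r.+1) expR (- l * Y s).
    by apply: eq_bigr => s _; rewrite mulNr.
  apply: le_trans (lerD (half l (ger0_norm l0)) (half (- l) lN)) _.
  rewrite -mulrDl (_ : 2 * X + 2 * X = 4 * X); last by ring.
  by rewrite ler_wpM2l // mulr_ge0 ?expR_ge0.
apply: le_trans (ler_wpM2l (expR_ge0 _) sum_le) _.
have -> : - (l * (psi * w)) = - (3^-1 * psi ^+ 2) - 3^-1 * psi ^+ 2.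
  by rewrite /l; field; exact: lt0r_neq0.
rewrite expRD; set Y1 := expR (- (_ * _)).
have XN : Y1 * X = 1 by rewrite -expRD addNr expR0.
have -> : Y1 * Y1 * (4 * X * (C * #|F|%:R)) = 4 * C * Y1 * #|F|%:R * (Y1 * X) by ring.
by rewrite XN mulr1.
Qed.
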